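(* Let $i\in\{3\frac{1}{2},4,5\}$. Let $X$ and $X'$ be locally connected locally compact $T_i$-spaces such that for every component $C$ of $X$ and every component $C'$ of $X'$ the Stone–Čech remainders $\beta C\setminus C$ and $\beta C'\setminus C'$ have cardinality at least $3$. If the partially ordered sets $(\mathscr{Y}_i(X),\leq)$ and $(\mathscr{Y}_i(X'),\leq)$ are order-isomorphic, then there is a bijection $C\mapsto C_\psi$ from the set of components of $X$ onto the set of components of $X'$ such that $\beta C\setminus C$ is homeomorphic to $\beta C_\psi\setminus C_\psi$ for every component $C$ of $X$. (That is, the order structure of $\mathscr{Y}_i(X)$ determines the faithfully indexed collection $\{\beta C\setminus C: C\text{ a component of }X\}$.)
   Context: Conventions: $T_{3\frac12}$ = completely regular and $T_1$; $T_4$ = normal and $T_1$; $T_5$ = hereditarily normal (every subspace normal) and $T_1$. $\beta C$ is the Stone–Čech compactification of $C$. A one-point connectification of $X$ is a connected space $Y$ containing $X$ as a dense subspace with $Y\setminus X$ a singleton; two are identified if there is a homeomorphism between them fixing every point of $X$. $\mathscr{Y}_i(X)$ is the set of (equivalence classes of) $T_i$ one-point connectifications of $X$, ordered by $Y_1\leq Y_2$ iff there is a continuous map $f:Y_2\to Y_1$ fixing every point of $X$. *)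

(* Defs.v *)
From HB Require Import structures.
From mathcomp Require Import all_boot all_order all_algebra.
From mathcomp Require Import all_classical all_reals all_analysis.
From mathcomp Require Import Rstruct Rstruct_topology.

Set Implicit Arguments.
Unset Strict Implicit.
Unset Printing Implicit Defensive.

Import Order.TTheory GRing.Theory Num.Theory.
Local Open Scope classical_set_scope.
Local Open Scope ring_scope.

Definition gen_top (T : choiceType) (S : set (set T)) : Type := T.
HB.instance Definition _ (T : choiceType) (S : set (set T)) :=
  Choice.on (gen_top S).
HB.instance Definition _ (T : choiceType) (S : set (set T)) :=
  @isSubBaseTopological.Build (gen_top S) (set T) S id.

Definition is_topology (T : choiceType) (S : set (set T)) : Prop :=
  @open (gen_top S) = S.

Definition completely_regular (T : topologicalType) : Prop :=
  forall (a : T) (B : set T), closed B -> ~ B a ->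
    exists f : T -> Rdefinitions.R,
      [/\ continuous f, (forall t, 0 <= f t <= 1), f a = 0 &
          forall b, B b -> f b = 1].

Definition hereditarily_normal (T : topologicalType) : Prop :=
  forall A : set T, normal_space (set_type A).

Inductive sep_index := T3half | T4 | T5.

Definition Ti (i : sep_index) (T : topologicalType) : Prop :=
  match i with
  | T3half => completely_regular T /\ accessible_space T
  | T4 => normal_space T /\ accessible_space T
  | T5 => hereditarily_normal T /\ accessible_space T
  end.

Definition locally_connected (T : topologicalType) : Prop :=
  forall (x : T) (U : set T), nbhs x U ->
    exists V : set T, [/\ open V, V x, connected V & V `<=` U].

Definition component (T : topologicalType) (C : set T) : Prop :=
  exists x : T, C = connected_component [set: T] x.

Definition embedding (Z K : topologicalType) (e : Z -> K) : Prop :=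
  [/\ continuous e, injective e &
      forall U : set Z, open U -> exists V : set K, open V /\ U = e @^-1` V].

Definition homeomorphic (A B : topologicalType) : Prop :=
  exists (f : A -> B) (g : B -> A),
    [/\ continuous f, continuous g, cancel f g & cancel g f].

Definition stone_cech (Z K : topologicalType) (e : Z -> K) : Prop :=
  [/\ compact [set: K], hausdorff_space K, embedding e, dense (range e) &
      forall (L : topologicalType) (f : Z -> L),
        compact [set: L] -> hausdorff_space L -> continuous f ->
        exists g : K -> L, continuous g /\ forall z, g (e z) = f z].

Definition sc_remainder (Z K : topologicalType) (e : Z -> K) : topologicalType :=
  set_type (~` range e).

(** * One-point connectifications.
    Every one-point extension Y of X is, via a homeomorphism fixing X, a
    topology on [option X] (X embedded by [Some], the new point is [None]);
    two such extensions are identified (homeomorphism fixing X) iff these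
    topologies coincide.  So the elements of Y_i(X) are represented by the
    topologies [S] on [option X] such that: the subspace topology on X
    induced via [Some] is the topology of X, X is dense, the space is
    connected and T_i. *)
Definition one_point_connectification (X : topologicalType)
    (S : set (set (option X))) : Prop :=
  [/\ is_topology S,
      (forall U : set X, open U <-> exists V, S V /\ U = Some @^-1` V),
      @dense (gen_top S) (range Some) &
      @connected (gen_top S) [set: gen_top S]].

Definition Yi (i : sep_index) (X : topologicalType) : set (set (set (option X))) :=
  [set S | one_point_connectification S /\ Ti i (gen_top S)].
Arguments Yi : clear implicits.

Definition conn_le (X : topologicalType) (S1 S2 : set (set (option X))) : Prop :=
  exists f : gen_top S2 -> gen_top S1,
    continuous f /\ forall x : X, f (Some x) = Some x.

Definition Yi_order_isomorphic (i : sep_index) (X X' : topologicalType) : Prop :=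
  exists phi : set (set (option X)) -> set (set (option X')),
    set_bij (Yi i X) (Yi i X') phi /\
    forall S1 S2, Yi i X S1 -> Yi i X S2 ->
      (conn_le S1 S2 <-> conn_le (phi S1) (phi S2)).

Definition card_ge3 (T : Type) : Prop :=
  exists a b c : T, [/\ a <> b, a <> c & b <> c].

(* Main.v *)
(** Let R_C be the remainder of the component C. A one-point connectification Y of
    X corresponds to a closed set F of the Stone-Cech remainder of X, larger Y to
    smaller F, and connectedness of Y means that F meets every R_C. Only the traces
    A_C of F on the clopen pieces R_C matter: each family (A_C) of nonempty closed
    sets has a largest connectification with these traces, and the maximal
    connectifications are those of the families of singletons, i.e. the points x
    of the product of the R_C. Those above Y are the points of the box with factors
    A_C. Hence an order isomorphism induces a bijection between the two products
    preserving closed boxes. Two-point boxes are the pairs of points differing in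
    one coordinate, so lines through a base point parallel to a coordinate axis go
    to such lines; this matches the components, and the boxes inside a line are the
    closed sets of its factor, so matched factors are homeomorphic. *)
Require Import Defs.
From HB Require Import structures.
From mathcomp Require Import all_boot all_order all_algebra.
From mathcomp Require Import all_classical all_reals all_analysis.
From mathcomp Require Import Rstruct Rstruct_topology.

Set Implicit Arguments.
Unset Strict Implicit.
Unset Printing Implicit Defensive.

Import Order.TTheory GRing.Theory Num.Theory.
Import numFieldTopology.Exports.
Local Open Scope classical_set_scope.
Local Open Scope ring_scope.

Local Notation R := Rdefinitions.R.

(** * Subspaces, embeddings and separation axioms *)

Lemma continuous_nbhs_open (T U : topologicalType) (f : T -> U) (x : T) :
  (forall W, open W -> W (f x) -> exists V, [/\ open V, V x & V `<=` f @^-1` W]) ->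
  {for x, continuous f}.
Proof.
move=> H W; rewrite nbhsE => -[V [oV Vfx] VW].
have [V' [oV' V'x V'V]] := H V oV Vfx.
by apply: (@filterS _ _ _ V'); [move=> y /V'V; exact: VW|exact: open_nbhs_nbhs].
Qed.

Lemma open_lt_preimage (T : topologicalType) (f : T -> R) (a : R) :
  continuous f -> open [set x | f x < a].
Proof.
move=> cf; apply: (open_comp (D := [set y | y < a])); last exact: open_lt.
by move=> ? _; exact: cf.
Qed.

Lemma open_gt_preimage (T : topologicalType) (f : T -> R) (a : R) :
  continuous f -> open [set x | a < f x].
Proof.
move=> cf; apply: (open_comp (D := [set y | a < y])); last exact: open_gt.
by move=> ? _; exact: cf.
Qed.

Lemma set_val_embedding (T : topologicalType) (A : set T) :
  embedding (set_val : set_type A -> T).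
Proof.
split.
- exact: initial_continuous.
- exact: val_inj.
- by move=> U [V oV <-]; exists V.
Qed.

Lemma continuous_to_set_type (Z T : topologicalType) (A : set T)
    (f : Z -> set_type A) :
  continuous (set_val \o f) -> continuous f.
Proof.
move=> cf; apply/continuousP => _ [V oV <-].
by rewrite -comp_preimage; move/continuousP: cf; apply.
Qed.

Lemma set_val_open_map (T : topologicalType) (A : set T) (U : set (set_type A)) :
  open A -> open U -> open (set_val @` U).
Proof.
move=> oA [V oV <-].
rewrite (_ : _ @` _ = A `&` V); first exact: openI.
apply/seteqP; split=> [x [y Vy <-]|x [Ax Vx]].
  by split => //; exact: (set_valP y).
by exists (exist _ x (mem_set Ax)).
Qed.

(** A cluster point in [T] of the image filter lies in [A] because [A] is closed, and it stays a
    cluster point in the subspace. *)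
Lemma compact_set_val_preimage (T : topologicalType) (A N : set T) :
  closed A -> compact N -> compact (set_val @^-1` N : set (set_type A)).
Proof.
move=> cA cN F PF FN.
have [|x [Nx clx]] := cN (set_val @ F) (fmap_proper_filter _ PF); first by [].
have Ax : A x.
  apply: cA => W Wx; have Frange : F (set_val @^-1` range (set_val : set_type A -> T)).
    by rewrite preimage_range; exact: filterT.
  have [x' [[b _ bx'] Wx']] := clx _ _ Frange Wx.
  by exists x'; split => //; rewrite -bx'; exact: (set_mem (svalP b)).
exists (exist _ x (mem_set Ax)); split => // B V FB [_ [[W oW <-] /= Wx] WV].
have FB' : F (set_val @^-1` (set_val @` B)).
  by apply: (@filterS _ F _ B) => //; exact: preimage_image.
have [x' [[b Bb bx'] Wx']] := clx _ _ FB' (open_nbhs_nbhs (conj oW Wx)).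
by exists b; split => //; apply: WV; rewrite /= bx'.
Qed.

Lemma compact_set_type (T : topologicalType) (A : set T) :
  closed A -> compact A -> compact [set: set_type A].
Proof.
move=> cA cptA; rewrite (_ : [set: _] = set_val @^-1` A).
  exact: compact_set_val_preimage.
by apply/seteqP; split => // -[x Ax] _; exact: set_mem.
Qed.

Lemma embedding_accessible (Z T : topologicalType) (e : Z -> T) :
  embedding e -> accessible_space T -> accessible_space Z.
Proof.
move=> [ce ie _] aT x y xy.
have [|U [oU xU yU]] := aT (e x) (e y).
  by apply: contra xy => /eqP/ie ->.
exists (e @^-1` U); split; first by move/continuousP: ce; exact.
- by move: xU; rewrite !inE.
- by move: yU; rewrite !inE.
Qed.

Lemma embedding_hausdorff (Z T : topologicalType) (e : Z -> T) :
  embedding e -> hausdorff_space T -> hausdorff_space Z.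
Proof.
move=> [ce ie _] hT x y xy; apply/ie/hT => U V Ux Vy.
by have [z [Uz Vz]] := xy _ _ (ce _ _ Ux) (ce _ _ Vy); exists (e z).
Qed.

Lemma embedding_completely_regular (Z T : topologicalType) (e : Z -> T) :
  embedding e -> completely_regular T -> completely_regular Z.
Proof.
move=> [ce ie oe] cT a B cB nBa.
have [V [oV BV]] := oe _ (closed_openC cB).
have Va : V (e a) by rewrite -[V _]/((e @^-1` V) a) -BV.
have [|f [cf f01 fa fV]] := cT (e a) (~` V) (open_closedC oV).
  by move=> /(_ Va).
exists (f \o e); split => //.
- by move=> x; apply: continuous_comp; [exact: ce|exact: cf].
- move=> t; exact: f01.
- move=> b Bb; apply: fV => Vb.
  by have : (e @^-1` V) b by []; rewrite -BV; apply.
Qed.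

Lemma normal_urysohn (T : topologicalType) (A B : set T) :
  normal_space T -> closed A -> closed B -> A `&` B = set0 ->
  exists f : T -> R, [/\ continuous f, (forall t, 0 <= f t <= 1),
    (forall a, A a -> f a = 0) & (forall b, B b -> f b = 1)].
Proof.
move=> nT cA cB AB; move/(@normal_separatorP R): nT => /(_ _ _ cA cB AB).
move=> /(@uniform_separatorP _ R)[f [cf f01 f0 f1]].
exists f; split => //.
- by move=> t; have : range f (f t) by []; move/f01; rewrite /= in_itv.
- by move=> a Aa; apply: f0; exists a.
- by move=> a Aa; apply: f1; exists a.
Qed.

Lemma T4_completely_regular (T : topologicalType) :
  normal_space T -> accessible_space T -> completely_regular T.
Proof.
move=> nT aT a B cB nBa.
have [||f [cf f01 fa fB]] := @normal_urysohn _ [set a] B nT _ cB.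
- exact: accessible_closed_set1.
- by apply/seteqP; split => // x [->].
- by exists f; split => //; exact: fa.
Qed.

Lemma completely_regular_hausdorff (T : topologicalType) :
  completely_regular T -> accessible_space T -> hausdorff_space T.
Proof.
move=> cT aT; rewrite open_hausdorff => x y xy.
have [||f [cf f01 fx fy]] := cT x [set y].
- exact: accessible_closed_set1.
- by move=> /= e; rewrite e eqxx in xy.
exists ([set z | f z < 2^-1], [set z | 2^-1 < f z]).
  by split; rewrite inE /= ?fx ?fy // ?invr_gt0 // invf_lt1 // ltr1n.
split; [exact: open_lt_preimage|exact: open_gt_preimage|].
by apply/eqP; apply/seteqP; split => // z [/= a b]; have := lt_trans a b; rewrite ltxx.
Qed.

Lemma homeomorphic_normal (T U : topologicalType) :
  homeomorphic T U -> normal_space T -> normal_space U.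
Proof.
move=> [f [g [cf cg fK gK]]] /(@normal_openP R) nT.
apply/(@normal_openP R) => A B cA cB AB.
have cl D : closed D -> closed (f @^-1` D).
  by move/continuous_closedP: cf; exact.
have op D : open D -> open (g @^-1` D).
  by move/continuousP: cg; exact.
have [|P [Q [oP oQ AP BQ PQ]]] := nT _ _ (cl _ cA) (cl _ cB).
  by rewrite -preimage_setI AB preimage_set0.
exists (g @^-1` P), (g @^-1` Q); split; [exact: op|exact: op| | |].
- by move=> a Aa; apply: AP; rewrite /= gK.
- by move=> a Aa; apply: BQ; rewrite /= gK.
- by rewrite -preimage_setI PQ preimage_set0.
Qed.

Lemma set_typeT_homeomorphic (T : topologicalType) :
  homeomorphic (set_type [set: T]) T.
Proof.
exists set_val, (fun x => exist _ x (mem_set I)); split.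
- exact: initial_continuous.
- by apply: continuous_to_set_type => x; exact: cvg_id.
- by move=> x; exact: val_inj.
- by [].
Qed.

Lemma Ti_completely_regular (i : sep_index) (T : topologicalType) :
  Ti i T -> completely_regular T /\ accessible_space T.
Proof.
case: i => -[h aT]; split => //; apply: T4_completely_regular => //.
apply: (homeomorphic_normal (@set_typeT_homeomorphic T)); exact: h.
Qed.

Lemma Ti_hausdorff (i : sep_index) (T : topologicalType) :
  Ti i T -> hausdorff_space T.
Proof. by move=> /Ti_completely_regular [? ?]; exact: completely_regular_hausdorff. Qed.

(** * Stone-Cech compactification *)

Lemma dense_range_meets (Z K : topologicalType) (e : Z -> K) (k : K) (U : set K) :
  dense (range e) -> nbhs k U -> exists z, U (e z).
Proof.
move=> de; rewrite nbhsE => -[V [oV Vk] VU].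
have [|x [Vx [z _ ezx]]] := de V _ oV; first by exists k.
by exists z; apply: VU; rewrite ezx.
Qed.

Lemma dense_range_eq (Z K L : topologicalType) (e : Z -> K) (f g : K -> L) :
  dense (range e) -> hausdorff_space L -> continuous f -> continuous g ->
  (forall z, f (e z) = g (e z)) -> forall k, f k = g k.
Proof.
move=> de hL cf cg fg k; apply: hL => A B fA gB.
have [z [Az Bz]] := dense_range_meets de
  (filterI (cf k A fA : nbhs k (f @^-1` A)) (cg k B gB : nbhs k (g @^-1` B))).
by exists (f (e z)); split => //; rewrite fg.
Qed.

(** Functions to the unit interval separate points from closed sets in a compact Hausdorff [L], so
    extending maps into [L] reduces to extending real-valued functions. *)
Lemma stone_cech_of_real_extension (Z K : topologicalType) (e : Z -> K) :
  compact [set: K] -> hausdorff_space K -> embedding e -> dense (range e) ->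
  (forall f : Z -> R, continuous f -> (forall z, 0 <= f z <= 1) ->
    exists g : K -> R, continuous g /\ forall z, g (e z) = f z) ->
  stone_cech e.
Proof.
move=> cK hK ee de ext; split => // L f cL hL cf.
have crL : completely_regular L.
  by apply: T4_completely_regular; [exact: compact_normal|exact: hausdorff_accessible].
have point_ext k : exists l, forall (h : L -> R) (g : K -> R), continuous h ->
    continuous g -> (forall z, g (e z) = h (f z)) -> h l = g k.
  (* The value at [k] is a cluster point of [f] along the neighbourhoods of [k] traced on [Z]. For
     each [h], continuity forces [h l] to be the value at [k] of the extension of [h \o f]. *)
  pose F := filter_from (nbhs k) (fun U => f @` (e @^-1` U)).
  have PF : ProperFilter F.
    apply: filter_from_proper => [|U /(dense_range_meets de) [z Uz]]; last first.
      by exists (f z), z.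
    apply: filter_from_filter; first by exists setT; exact: filterT.
    move=> U V kU kV; exists (U `&` V); first exact: filterI.
    by move=> _ [z [Uz Vz] <-]; split; exists z.
  have [l [_ Fl]] := cL F PF filterT.
  exists l => h g ch cg gh; apply: Rhausdorff => A B hA gB.
  have [] := Fl (f @` (e @^-1` (g @^-1` B))) (h @^-1` A).
  - by exists (g @^-1` B) => //; exact: cg.
  - exact: ch.
  - by move=> _ [[z /= Bz <-] Az]; exists (h (f z)); split => //; rewrite -gh.
have [g gP] := choice point_ext; exists g; split; last first.
  move=> z; apply: contrapT => /eqP gz.
  have [||h [ch h01 h0 h1]] := crL (g (e z)) [set f z].
  - exact/accessible_closed_set1/hausdorff_accessible.
  - by move=> /= e0; rewrite e0 eqxx in gz.
  have [||g' [cg' g'E]] := ext (h \o f).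
  - by move=> t; apply: continuous_comp; [exact: cf|exact: ch].
  - by move=> t; exact: h01.
  have := gP (e z) h g' ch cg' g'E.
  by rewrite h0 g'E /= h1 // => /eqP; rewrite eq_sym oner_eq0.
move=> k; apply: continuous_nbhs_open => W oW Wg.
have [||h [ch h01 h0 h1]] := crL (g k) (~` W).
- exact: open_closedC.
- by move=> /(_ Wg).
have [||g' [cg' g'E]] := ext (h \o f).
- by move=> t; apply: continuous_comp; [exact: cf|exact: ch].
- by move=> t; exact: h01.
(* Where the extension [g'] of [h \o f] is below 1, [g] cannot leave [W], since [h] is 1 off [W]. *)
exists [set k' | g' k' < 1]; split.
- exact: open_lt_preimage.
- by rewrite /= -(gP k h g' ch cg' g'E) h0.
- move=> k' /=; rewrite -(gP k' h g' ch cg' g'E) => hk'.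
  by apply: contrapT => /h1 hk1; rewrite hk1 ltxx in hk'.
Qed.

(** The universal property speaks of compact targets, so [f] is corestricted to the unit
    interval. *)
Lemma stone_cech_real_extension (Z K : topologicalType) (e : Z -> K) (f : Z -> R) :
  stone_cech e -> continuous f -> (forall z, 0 <= f z <= 1) ->
  exists g : K -> R, continuous g /\ forall z, g (e z) = f z.
Proof.
move=> [_ _ _ _ ext] cf f01.
have fI z : f z \in `[0, 1]%classic by rewrite inE /= in_itv; exact: f01.
pose f' z : set_type `[0 : R, 1]%classic := exist _ (f z) (fI z).
have [||/=|g [cg gE]] := ext _ f'.
- by apply: compact_set_type; [exact: interval_closed|exact: segment_compact].
- exact: (embedding_hausdorff (set_val_embedding _) (@Rhausdorff _)).
- exact: continuous_to_set_type.
exists (set_val \o g); split=> [k|z].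
  by apply: continuous_comp; [exact: cg|exact: initial_continuous].
by rewrite /= gE.
Qed.

(** The compactification is the closure of the image of [Z] in the power of the reals indexed by the
    continuous functions to the unit interval. Such a function extends as the projection to its own
    coordinate. *)
Lemma stone_cech_exists (Z : topologicalType) :
  completely_regular Z -> accessible_space Z ->
  exists (K : topologicalType) (e : Z -> K), stone_cech e.
Proof.
move=> crZ aZ.
pose J : choiceType := set_type [set f : Z -> R | continuous f /\ forall z, 0 <= f z <= 1].
have Jc (j : J) : continuous (\val j) by case: j => f /= /set_mem [].
have J01 (j : J) z : 0 <= (\val j) z <= 1 by case: j => f /= /set_mem [].
have sepJ : separate_points_from_closed (fun j : J => \val j : Z -> R).
  move=> U x cU nUx; have [f [cf f01 f0 f1]] := crZ x U cU nUx.
  have fJ : f \in [set f : Z -> R | continuous f /\ forall z, 0 <= f z <= 1].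
    exact/mem_set.
  exists (exist _ f fJ) => /=; rewrite f0 => /(_ [set y | y < 1]) [].
    by apply: open_nbhs_nbhs; split; [exact: open_lt|rewrite /= ltr01].
  by move=> _ [[u Uu <-]] /=; rewrite f1 // ltxx.
pose ev : Z -> {ptws J -> R} := join_product (fun j : J => \val j : Z -> R).
have cev : continuous ev by exact: join_product_continuous.
have iev : set_inj [set: Z] ev by exact: join_product_inj.
have hP : hausdorff_space {ptws J -> R}.
  by apply: hausdorff_product => j; exact: Rhausdorff.
have cC : compact (closure (range ev)).
  have cc : compact [set p : {ptws J -> R} | forall j, `[0, 1]%classic (p j)].
    exact: (@tychonoff J (fun=> R) (fun=> `[0, 1]%classic) (fun=> @segment_compact R 0 1)).
  apply: (subclosed_compact _ cc); first exact: closed_closure.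
  move/closure_id: (compact_closed hP cc) => ->; apply: closureS => _ [z _ <-] j.
  by rewrite /= in_itv; exact: J01.
have evC z : closure (range ev) (ev z) by apply: subset_closure; exists z.
pose e z : set_type (closure (range ev)) := exist _ (ev z) (mem_set (evC z)).
exists (set_type (closure (range ev))), e.
apply: stone_cech_of_real_extension.
- by apply: compact_set_type => //; exact: closed_closure.
- exact: embedding_hausdorff (set_val_embedding _) hP.
- split.
  + exact: continuous_to_set_type.
  + by move=> x y /(congr1 set_val)/=; apply: iev; rewrite inE.
  + move=> U; rewrite (join_product_initial sepJ Jc iev) => -[V oV <-].
    by exists (set_val @^-1` V); split; [exists V|].
- move=> U [[p Cp] Up] [V oV UV]; subst U.
  have [|q [[z _ evz] Vq]] := set_mem Cp V; first exact: open_nbhs_nbhs.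
  by subst q; exists (e z); split => //; exists z.
move=> f cf f01.
have fJ : f \in [set f : Z -> R | continuous f /\ forall z, 0 <= f z <= 1].
  exact/mem_set.
exists (fun k => set_val k (exist _ f fJ)); split => // k.
apply: (@continuous_comp _ _ _ set_val (fun p : {ptws J -> R} => p (exist _ f fJ))).
  exact: initial_continuous.
exact: (@proj_continuous J (fun=> R) (exist _ f fJ)).
Qed.

(** A lift [h] in the other direction satisfies [h (g k) = k] by density. Hence [g k = e' z] would
    give [k = e z], and remainder points go to remainder points. *)
Lemma stone_cech_lift (Z K L : topologicalType) (e : Z -> K) (e' : Z -> L) :
  stone_cech e -> stone_cech e' ->
  exists g : K -> L, [/\ continuous g, forall z, g (e z) = e' z &
    forall k, ~ range e k -> ~ range e' (g k)].
Proof.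
move=> [cK hK [ce ie _] de extK] [cL hL [ce' ie' _] de' extL].
have [g [cg gE]] := extK L e' cL hL ce'.
have [h [ch hE]] := extL K e cK hK ce.
have hg : forall k, h (g k) = id k.
  apply: (dense_range_eq de hK) => [k|k|z]; [|exact: cvg_id|by rewrite gE hE].
  by apply: continuous_comp; [exact: cg|exact: ch].
exists g; split => // k nk [z _ gk]; apply: nk; exists z => //.
by rewrite -hE gk hg.
Qed.

(** This allows one compactification to be fixed per component and the result to be transferred to
    any other. *)
Lemma stone_cech_remainder_unique (Z K L : topologicalType) (e : Z -> K) (e' : Z -> L) :
  stone_cech e -> stone_cech e' -> homeomorphic (sc_remainder e) (sc_remainder e').
Proof.
move=> se se'.
have [g [cg gE gr]] := stone_cech_lift se se'.
have [h [ch hE hr]] := stone_cech_lift se' se.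
have hg : forall k, h (g k) = id k.
  case: se => _ hK _ de _.
  apply: (dense_range_eq de hK) => [k|k|z]; [|exact: cvg_id|by rewrite gE hE].
  by apply: continuous_comp; [exact: cg|exact: ch].
have gh : forall k, g (h k) = id k.
  case: se' => _ hK _ de _.
  apply: (dense_range_eq de hK) => [k|k|z]; [|exact: cvg_id|by rewrite hE gE].
  by apply: continuous_comp; [exact: ch|exact: cg].
pose g' (x : sc_remainder e) : sc_remainder e' :=
  exist _ (g (\val x)) (mem_set (gr _ (set_mem (svalP x)))).
pose h' (x : sc_remainder e') : sc_remainder e :=
  exist _ (h (\val x)) (mem_set (hr _ (set_mem (svalP x)))).
exists g', h'; split.
- apply: (@continuous_to_set_type _ _ _ g') => x.
  apply: (@continuous_comp _ _ _ set_val g); last exact: cg.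
  exact: (@initial_continuous _ _ set_val x).
- apply: (@continuous_to_set_type _ _ _ h') => x.
  apply: (@continuous_comp _ _ _ set_val h); last exact: ch.
  exact: (@initial_continuous _ _ set_val x).
- by move=> x; apply: val_inj; exact: hg.
- by move=> x; apply: val_inj; exact: gh.
Qed.

(** * Bijections of products preserving closed boxes *)

Definition box (I : Type) (P : I -> Type) (B : forall c, set (P c)) :
  set (forall c, P c) := [set x | forall c, B c (x c)].

Definition closed_family (I : Type) (P : I -> topologicalType)
  (B : forall c, set (P c)) := forall c, closed (B c) /\ B c !=set0.

(** For a bijection [s] this says that images of closed boxes are closed boxes. *)
Definition box_preserving (I I' : Type) (P : I -> topologicalType)
    (P' : I' -> topologicalType) (s : (forall c, P c) -> forall c, P' c) :=
  forall B, closed_family B -> exists B', closed_family B' /\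
    forall x, box B x <-> box B' (s x).

Definition differ_only_at (I : Type) (P : I -> Type) (c : I) (x y : forall c, P c) :=
  x c <> y c /\ forall d, d <> c -> x d = y d.

Section box_preserving_bijection.
Variables (I I' : eqType) (P : I -> topologicalType) (P' : I' -> topologicalType).
Hypothesis closed1 : forall c (r : P c), closed [set r].
Variables (s : (forall c, P c) -> forall c, P' c) (t : (forall c, P' c) -> forall c, P c).
Hypotheses (sK : cancel s t) (tK : cancel t s).
Hypothesis s_box : box_preserving s.

(* A pair of points is a closed box exactly when they differ in one coordinate. *)
Lemma differ_only_at_image c x y :
  differ_only_at c x y -> exists c', differ_only_at c' (s x) (s y).
Proof.
move=> [xyc xy].
have [B' [B'cl B'P]] : exists B', closed_family B' /\
    forall z, box (fun d => [set x d; y d]) z <-> box B' (s z).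
  apply: s_box => d; split; last by exists (x d); left.
  by apply: closedU; exact: closed1.
have Bxy z : box (fun d => [set x d; y d]) z -> z = x \/ z = y.
  move=> Bz; have [zc|zc] := Bz c; [left|right]; apply: functional_extensionality_dep => d.
    have [->//|/eqP dc] := eqVneq d c.
    by case: (Bz d) => // ->; rewrite xy.
  have [->//|/eqP dc] := eqVneq d c.
  by case: (Bz d) => // ->; rewrite xy.
have B'x : box B' (s x) by apply/B'P => d; left.
have B'y : box B' (s y) by apply/B'P => d; right.
have [c' c'P] : exists c', s x c' <> s y c'.
  apply: contrapT => /forallNP H; apply: xyc.
  suff -> : x = y by [].
  apply: (can_inj sK); apply: functional_extensionality_dep => d.
  by apply: contrapT; exact: H.
exists c'; split => // d dc'; apply: contrapT => xyd.
(* If the images also differed at [d], this mixed point would be a third point of the box [B'],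
   which contains only [s x] and [s y]. *)
pose z := dfwith (s x) c' (s y c').
have : box B' (s (t z)).
  rewrite tK => e; rewrite /z; case: dfwithP => [|e' _]; first exact: B'y.
  exact: B'x.
move/B'P/Bxy => tz.
have zc' : z c' = s y c' by rewrite /z dfwithin.
have zd : z d = s x d by rewrite /z dfwithout //; apply/eqP => e; exact: dc'.
by case: tz => /(congr1 s); rewrite tK => zE; [apply: c'P|apply: xyd];
  rewrite -?zc' -?zd zE.
Qed.

(** The three points lie on one line, so their images pairwise differ in at most one coordinate. If
    [s z] left the line through [s x] and [s y], it would differ from [s y] both at [c'] and at
    another coordinate. *)
Lemma line_image c c' x y z :
  differ_only_at c x y -> differ_only_at c' (s x) (s y) ->
  (forall d, d <> c -> z d = x d) -> forall d, d <> c' -> s z d = s x d.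
Proof.
move=> [xyc xy] [sxyc sxy] zx d dc'.
have [zcx|zcx] := pselect (x c = z c).
  suff -> : z = x by [].
  apply: functional_extensionality_dep => e.
  by have [->//|/eqP /zx] := eqVneq e c.
have [d' [d'P sxz]] : exists d', differ_only_at d' (s x) (s z).
  by apply: (@differ_only_at_image c); split => // e ec; rewrite zx.
have [d'c'|d'c'] := eqVneq d' c'.
  by subst d'; rewrite sxz.
have [yzc|yzc] := pselect (y c = z c).
  have yz : y = z.
    apply: functional_extensionality_dep => e.
    have [->//|/eqP ec] := eqVneq e c.
    by rewrite -xy // zx.
  by rewrite -yz -sxy.
have [e' [_ syz]] : exists e', differ_only_at e' (s y) (s z).
  by apply: (@differ_only_at_image c); split => // e ec; rewrite -xy // zx.
have [c'e|c'e] := eqVneq c' e'; last first.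
  exfalso; apply: sxyc; rewrite syz; last exact/eqP.
  by rewrite sxz //; apply/eqP; rewrite eq_sym.
exfalso; apply: d'P; rewrite sxy; last exact/eqP.
by rewrite syz // -c'e; exact/eqP.
Qed.

Hypothesis closed1' : forall c (r : P' c), closed [set r].
Hypothesis t_box : box_preserving t.

(** A closed [D] in the factor [c'], completed by the singletons of the other coordinates of [s x],
    is a closed box, which [t] maps to a closed box. The preimage of [D] is the factor [B c] of that
    box, or empty if some other coordinate of [x] lies outside [B]. *)
Lemma line_continuous c c' x :
  (forall z, (forall d, d <> c -> z d = x d) -> forall d, d <> c' -> s z d = s x d) ->
  continuous (fun r : P c => s (dfwith x c r) c').
Proof.
move=> line; apply/continuous_closedP => D cD.
have [->|/set0P D0] := eqVneq D set0; first by rewrite preimage_set0; exact: closed0.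
pose B' := dfwith (fun d => [set s x d]) c' D.
have [|B [Bcl BP]] := t_box (B := B').
  by move=> d; rewrite /B'; case: dfwithP => [//|e _]; split; [exact: closed1'|exists (s x e)].
have DE r : D (s (dfwith x c r) c') <-> box B (dfwith x c r).
  rewrite -[X in box B X]sK -BP; split=> [Dr d|/(_ c')]; last by rewrite /B' dfwithin.
  rewrite /B'; case: dfwithP => // e /eqP ce /=; apply: line => [d' d'c|].
    by rewrite dfwithout //; apply/eqP => ?; apply: d'c.
  by move=> ?; apply: ce.
have [H|H] := pselect (forall d, d <> c -> B d (x d)).
  rewrite (_ : _ @^-1` _ = B c); first by have [] := Bcl c.
  apply/seteqP; split=> r /=; rewrite DE; first by move=> /(_ c); rewrite dfwithin.
  by move=> Br d; case: dfwithP => // e /eqP ce; apply: H => ?; apply: ce.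
rewrite (_ : _ @^-1` _ = set0); first exact: closed0.
apply/seteqP; split=> // r /=; rewrite DE => Br; apply: H => d dc.
by move: (Br d); rewrite dfwithout //; apply/eqP => ?; apply: dc.
Qed.

(** Since [s] maps the line into a line, [s (dfwith x c r)] is rebuilt from [s x] and its coordinate
    at [c']. *)
Lemma line_cancel c c' x (r : P c) :
  (forall z, (forall d, d <> c -> z d = x d) -> forall d, d <> c' -> s z d = s x d) ->
  t (dfwith (s x) c' (s (dfwith x c r) c')) c = r.
Proof.
move=> line; rewrite (_ : dfwith (s x) _ _ = s (dfwith x c r)).
  by rewrite sK dfwithin.
apply: functional_extensionality_dep => d; case: dfwithP => // e /eqP ce.
apply/esym/line => [d' d'c|ec]; last exact/ce/esym.
by rewrite dfwithout //; apply/eqP => cd; exact/d'c/esym.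
Qed.
End box_preserving_bijection.

(** The index [f c] is the direction of the image under [s] of the line through [x] in direction
    [c]; [g] arises from [t] in the same way. A second point in each factor makes these directions
    well determined. *)
Lemma box_preserving_factors (I I' : eqType) (P : I -> topologicalType)
    (P' : I' -> topologicalType) (s : (forall c, P c) -> forall c, P' c)
    (t : (forall c, P' c) -> forall c, P c) (x : forall c, P c) :
  (forall c (r : P c), closed [set r]) -> (forall c (r : P' c), closed [set r]) ->
  (forall c (r : P c), exists r', r <> r') -> (forall c (r : P' c), exists r', r <> r') ->
  cancel s t -> cancel t s -> box_preserving s -> box_preserving t ->
  exists (f : I -> I') (g : I' -> I),
    [/\ cancel f g, cancel g f & forall c, homeomorphic (P c) (P' (f c))].
Proof.
move=> cl cl' ne ne' sK tK sB tB.
have move_at (J : eqType) (Q : J -> topologicalType) (y : forall c, Q c) c :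
    (forall c (r : Q c), exists r', r <> r') -> exists y', differ_only_at c y y'.
  move=> /(_ c (y c)) [r yr]; exists (dfwith y c r); split; first by rewrite dfwithin.
  by move=> d dc; rewrite dfwithout //; apply/eqP => e; exact/dc/esym.
have /choice[f fP] : forall c, exists c', exists y,
    differ_only_at c x y /\ differ_only_at c' (s x) (s y).
  move=> c; have [y xy] := move_at _ _ x c ne.
  by have [c' sxy] := differ_only_at_image cl sK tK sB xy; exists c', y.
have /choice[g gP] : forall c', exists c, exists y,
    differ_only_at c' (s x) y /\ differ_only_at c (t (s x)) (t y).
  move=> c'; have [y xy] := move_at _ _ (s x) c' ne'.
  by have [c sxy] := differ_only_at_image cl' tK sK tB xy; exists c, y.
have sline c z : (forall d, d <> c -> z d = x d) -> forall d, d <> f c -> s z d = s x d.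
  by have [y [xy sxy]] := fP c; exact: (line_image cl sK tK sB xy sxy).
have tline c z : (forall d, d <> c -> z d = s x d) ->
    forall d, d <> g c -> t z d = t (s x) d.
  by have [y [xy sxy]] := gP c; exact: (line_image cl' tK sK tB xy sxy).
have fK : cancel f g.
  (* [t] sends [s y] to the line through [x] in direction [g (f c)], whereas [y] differs from [x] at
     [c]. *)
  move=> c; apply: contrapT => gfc; have [y [[xyc xy] [_ sxy]]] := fP c.
  apply: xyc; rewrite -(sK x) -(sK y); apply/esym/(tline (f c)) => [d dc|e].
    exact/esym/sxy.
  exact/gfc/esym.
have gK : cancel g f.
  move=> c; apply: contrapT => fgc; have [y [[xyc xy] [_ txy]]] := gP c.
  apply: xyc; rewrite -[y]tK; apply/esym/(sline (g c)) => [d dc|e].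
    by rewrite -txy // sK.
  exact/fgc/esym.
exists f, g; split => // c.
have tline' z : (forall d, d <> f c -> z d = s x d) ->
    forall d, d <> c -> t z d = t (s x) d.
  by move=> zx d dc; apply: (tline (f c)) => //; rewrite fK.
exists (fun r => s (dfwith x c r) (f c)), (fun r => t (dfwith (s x) (f c) r) c); split.
- exact: (line_continuous sK cl' tB (sline c)).
- exact: (line_continuous tK cl sB tline').
- by move=> r; exact: line_cancel (sline c).
- by move=> r; rewrite -[X in s (dfwith X _ _)]sK; exact: line_cancel tline'.
Qed.

(** * One-point connectifications *)

Lemma set_val_closed_map (T : topologicalType) (A : set T) (B : set (set_type A)) :
  closed A -> closed B -> closed (set_val @` B).
Proof.
move=> cA /closed_openC [V oV BV].
rewrite (_ : _ @` _ = A `&` ~` V); first by apply: closedI => //; exact: open_closedC.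
have BVE (b : set_type A) : B b <-> ~ V (set_val b).
  rewrite -[V _]/((set_val @^-1` V) b) BV; split; first by move=> Bb /(_ Bb).
  exact: contrapT.
apply/seteqP; split=> [x [b /BVE Vb <-]|x [Ax Vx]].
  by split => //; exact: (set_mem (svalP b)).
by exists (exist _ x (mem_set Ax)) => //; apply/BVE.
Qed.

Lemma closed_set_type_locally_compact (T : topologicalType) (A : set T) :
  closed A -> locally_compact [set: T] -> locally_compact [set: set_type A].
Proof.
move=> cA lT x _; have [N] := lT (set_val x) I; rewrite !withinET => xN [cN clN].
have xN' : nbhs x (set_val @^-1` N) by exact: (@initial_continuous _ _ set_val x).
exists (set_val @^-1` N); first by apply: (@filterS _ _ _ (set_val @^-1` N)) xN'.
split; first exact: compact_set_val_preimage.
by apply: preimage_closed => // y _; exact: initial_continuous.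
Qed.

Lemma stone_cech_open_range (Z K : topologicalType) (e : Z -> K) :
  locally_compact [set: Z] -> stone_cech e -> open (range e).
Proof.
move=> lZ [cK hK [ce ie oe] de _]; rewrite openE => _ [z _ <-].
have [N] := lZ z I; rewrite withinET nbhsE => -[U [oU Uz] UN] [cN _].
have [V [oV UV]] := oe U oU.
have Vz : V (e z) by rewrite -[V _]/((e @^-1` V) z) -UV.
apply: (@filterS _ _ _ V); last exact: open_nbhs_nbhs.
have ceN : closed (e @` N).
  by apply: compact_closed => //; apply: continuous_compact => //; exact: continuous_subspaceT.
suff Vsub : V `<=` e @` N by move=> k /Vsub [y _ <-]; exists y.
move=> k Vk; apply: ceN => W Wk.
have [y [Vy Wy]] := dense_range_meets de (filterI (open_nbhs_nbhs (conj oV Vk)) Wk).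
exists (e y); split => //; exists y => //; apply: UN.
by rewrite UV.
Qed.

Lemma completely_regular_separation (T : topologicalType) (a : T) (B : set T) :
  completely_regular T -> closed B -> ~ B a ->
  exists P Q : set T, [/\ open P, open Q, P a, B `<=` Q & P `&` Q = set0].
Proof.
move=> crT cB nBa; have [f [cf _ fa fB]] := crT a B cB nBa.
exists [set x | f x < 2^-1], [set x | 2^-1 < f x]; split.
- exact: open_lt_preimage.
- exact: open_gt_preimage.
- by rewrite /= fa invr_gt0.
- by move=> b /fB /= ->; rewrite invf_lt1 // ltr1n.
- by apply/seteqP; split => // x [/= /lt_trans h /h]; rewrite ltxx.
Qed.

(** At most one point is added to [Z], and it lies in at most one of two disjoint closed sets. The
    lemma serves T4 for an extension and T5 for all its subspaces. *)
Lemma one_point_extension_normal (Z Y : topologicalType) (j : Z -> Y) :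
  normal_space Z -> completely_regular Y ->
  continuous j -> injective j -> (forall U, open U -> open (j @` U)) ->
  (forall y y', ~ range j y -> ~ range j y' -> y = y') ->
  normal_space Y.
Proof.
move=> /(@normal_openP R) nZ crY cj ij oj j1.
have sep (A B : set Y) : closed A -> closed B -> A `&` B = set0 ->
    (forall p, ~ range j p -> ~ A p) ->
    exists U V, [/\ open U, open V, A `<=` U, B `<=` V & U `&` V = set0].
  move=> cA cB AB pA.
  (* [V] surrounds the added point and [Q] surrounds [A]; without an added point the empty set and
     the whole space will do. *)
  have [V [Q [oV oQ pV AQ VQ]]] : exists V Q : set Y, [/\ open V, open Q,
      (forall p, ~ range j p -> V p), A `<=` Q & V `&` Q = set0].
    have [[p jp]|np] := pselect (exists p, ~ range j p).
      have [V [Q [oV oQ Vp AQ VQ]]] :=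
        completely_regular_separation crY cA (pA p jp).
      by exists V, Q; split => // q jq; rewrite (j1 q p).
    exists set0, setT; split; [exact: open0|exact: openT| |by []|exact: set0I].
    by move=> p jp; apply: np; exists p.
  have cl D : closed D -> closed (j @^-1` D) by move/continuous_closedP: cj; exact.
  (* Adjoining the complement of [Q] to [B] forces [U1] into the preimage of [Q], so the image of
     [U1] misses [V]. *)
  have [|U1 [U2 [oU1 oU2 AU1 BU2 U12]]] :=
      nZ (j @^-1` A) (j @^-1` (B `|` ~` Q)) (cl _ cA) (cl _ (closedU cB (open_closedC oQ))).
    rewrite -preimage_setI setIUr AB set0U (_ : A `&` ~` Q = set0) ?preimage_set0 //.
    by apply/seteqP; split => // x [/AQ].
  have U12' z : U1 z -> ~ U2 z.
    by move=> h1 h2; have : (U1 `&` U2) z by []; rewrite U12.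
  exists (j @` U1), (j @` U2 `|` V); split.
  - exact: oj.
  - by apply: openU => //; exact: oj.
  - move=> a Aa; have [[z _ za]|ja] := pselect (range j a); last by case: (pA a ja).
    by exists z => //; apply: AU1; rewrite /= za.
  - move=> b Bb; have [[z _ zb]|jb] := pselect (range j b); last by right; exact: pV.
    by left; exists z => //; apply: BU2; left; rewrite /= zb.
  - apply/seteqP; split => // _ [[z U1z <-]] [[z' U2z' /ij zz']|Vz].
      by apply: (U12' z) => //; rewrite -zz'.
    apply: (U12' z) => //; apply: BU2; right => /= Qz.
    by have : (V `&` Q) (j z) by []; rewrite VQ.
apply/(@normal_openP R) => A B cA cB AB.
have [pA|] := pselect (forall p, ~ range j p -> ~ A p); first exact: sep.
move=> /existsNP [p /not_implyP [jp /contrapT Ap]].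
have [|q jq Bq|U [V [oU oV BU AV UV]]] := sep B A cB cA.
- by rewrite setIC.
- have : (A `&` B) p by split => //; rewrite (j1 p q).
  by rewrite AB.
- by exists V, U; split => //; rewrite setIC.
Qed.

(** [gen_top] takes [S] as a subbase; under these closure properties generation adds no new set. *)
Lemma is_topologyP (T : choiceType) (S : set (set T)) :
  S setT -> (forall A B, S A -> S B -> S (A `&` B)) ->
  (forall F : set (set T), F `<=` S -> S (\bigcup_(A in F) A)) ->
  is_topology S.
Proof.
move=> ST SI SU.
have Sfin (s : seq (set T)) : {subset s <= S} -> S (\bigcap_(A in [set` s]) A).
  move=> sS; rewrite bigcap_seq big_seq; apply: (big_ind S) => // A As.
  by have := sS A As; rewrite inE.
apply/seteqP; split => A.
  move=> [D DS <-]; apply: SU => B /DS [F FS <-]; apply: Sfin => C CF.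
  exact: FS.
move=> SA; exists [set A]; last by rewrite bigcup_set1.
by move=> _ ->; exact: finI_from1.
Qed.

Section one_point_connectification_topology.
Variables (X : topologicalType) (S : set (set (option X))).
Hypothesis oS : one_point_connectification S.

Let openS : @open (gen_top S) = S. Proof. by case: oS. Qed.

Lemma Some_continuous : continuous (Some : X -> gen_top S).
Proof.
apply/continuousP => V; rewrite openS => SV.
by case: oS => _ /(_ (Some @^-1` V)) [_ H] _ _; apply: H; exists V.
Qed.

(** T1 makes the new point closed, so it can be removed from an open set that traces [U] on [X]. *)
Lemma Some_open (U : set X) :
  accessible_space (gen_top S) -> open U -> S (Some @` U).
Proof.
move=> aS oU; have [V [SV UV]] : exists V, S V /\ U = Some @^-1` V.
  by case: oS => _ /(_ U) [H _] _ _; exact: H.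
rewrite -openS (_ : Some @` U = V `&` ~` [set (None : gen_top S)]).
  apply: openI; first by rewrite openS.
  by apply: closed_openC; exact: accessible_closed_set1.
apply/seteqP; split=> [_ [x Ux <-]|[x|] [Vx //= nx]]; last by exists x => //; rewrite UV.
by split => //; rewrite UV in Ux.
Qed.

End one_point_connectification_topology.

(* A map fixing X sends the new point to the new point: if it went to x in X,
   then x and the new point could not be separated in the finer topology. *)
Lemma conn_leE (i : sep_index) (X : topologicalType) (S1 S2 : set (set (option X))) :
  Yi i X S1 -> Yi i X S2 -> (conn_le S1 S2 <-> S1 `<=` S2).
Proof.
move=> [S1c T1] [S2c T2].
have op1 : @open (gen_top S1) = S1 by case: S1c.
have op2 : @open (gen_top S2) = S2 by case: S2c.
split=> [[f [cf fS]]|S12]; last first.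
  by exists id; split => //; apply/continuousP => U; rewrite op1 op2 => /S12.
suff fN : f None = None.
  move=> U S1U.
  move/continuousP: cf => /(_ U); rewrite op1 op2 => /(_ S1U).
  by rewrite (_ : f @^-1` U = U) //; apply/seteqP; split=> -[x|]; rewrite /= ?fS ?fN.
case E : (f None) => [x|//]; exfalso.
have [U [V [oU oV Ux VN UV]]] : exists U V : set (option X),
    [/\ S2 U, S2 V, U (Some x), V None & U `&` V = set0].
  have := Ti_hausdorff T2; rewrite open_hausdorff => /(_ (Some x) None isT).
  move=> [[U V] /= [Ux VN] [oU oV /eqP UV]]; exists U, V.
  by split; [rewrite -op2|rewrite -op2|exact: set_mem|exact: set_mem|].
have oSU : open (Some @^-1` U).
  by have /continuousP := Some_continuous S2c; apply; rewrite op2.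
have S1U : S1 (Some @` (Some @^-1` U)).
  by apply: (Some_open S1c) => //; have [] := Ti_completely_regular T1.
have : S2 (f @^-1` (Some @` (Some @^-1` U)) `&` V).
  rewrite -op2; apply: openI; last by rewrite op2.
  by move/continuousP: cf; apply; rewrite op1.
move=> W2.
have [_ _ dS _] := S2c.
have [||y [[[x' Ux' x'y] Vy] [y' _ yy']]] := dS (f @^-1` (Some @` (Some @^-1` U)) `&` V).
- by exists None; split => //=; exists x.
- by rewrite op2.
have : (U `&` V) y by split => //; rewrite -yy'; move: x'y; rewrite -yy' fS => -[<-].
by rewrite UV.
Qed.

(** * Topological sums of connected pieces and their one-point extensions *)

Section sum_of_components.
Variables (X : topologicalType) (I : Type) (Z : I -> topologicalType).
Variable j : forall c, Z c -> X.
Hypothesis j_continuous : forall c, continuous (@j c).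
Hypothesis j_open : forall c U, open U -> open (@j c @` U).
Hypothesis j_inj : forall c, injective (@j c).
Hypothesis j_disjoint : forall c c' z z', j (c := c) z = j (c := c') z' -> c = c'.
Hypothesis j_surj : forall x, exists c (z : Z c), j z = x.
Hypothesis j_connected : forall c, connected (range (@j c)).
Hypothesis Z_point : forall c, exists z : Z c, True.
Hypothesis Z_locally_compact : forall c, locally_compact [set: Z c].
Variables (K : I -> topologicalType) (e : forall c, Z c -> K c).
Hypothesis e_stone_cech : forall c, stone_cech (@e c).
Arguments j {c}.
Arguments e {c}.

Local Notation rem c := (sc_remainder (@e c)).

Lemma sum_openP (U : set X) : (forall c, open (@j c @^-1` U)) -> open U.
Proof.
move=> oU; rewrite (_ : U = \bigcup_c (j @` (@j c @^-1` U))).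
  by apply: bigcup_open => c _; exact: j_open.
apply/seteqP; split=> [x Ux|x [c _ [z Uz <-]] //].
by have [c [z zx]] := j_surj x; exists c => //; exists z => //=; rewrite zx.
Qed.

Lemma sum_continuousP (T : topologicalType) (f : X -> T) :
  (forall c, continuous (f \o @j c)) -> continuous f.
Proof.
move=> cf; apply/continuousP => U oU; apply: sum_openP => c.
by move/continuousP: (cf c) => /(_ U oU).
Qed.

Lemma sum_glue (T : Type) (h : forall c, Z c -> T) :
  exists f : X -> T, forall c z, f (@j c z) = h c z.
Proof.
have /choice[p pP] : forall x, exists p : {c & Z c}, j (projT2 p) = x.
  by move=> x; have [c [z zx]] := j_surj x; exists (existT _ c z).
exists (fun x => h _ (projT2 (p x))) => c z.
move: (pP (j z)); case: (p (j z)) => c' z' /= jz'.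
have cc' := j_disjoint jz'; subst c'.
by rewrite (j_inj jz').
Qed.

(* The points of the remainder of the component [c] that lie in the closed
   subset of the Stone-Cech remainder of X corresponding to [S]. *)
Definition trace (S : set (set (option X))) c : set (rem c) :=
  [set r | forall O, S O -> O None ->
    closure (e @` [set z | O (Some (j z))]) (\val r)].
Arguments trace : clear implicits.

(* The quotient of the Stone-Cech compactification of X in which the closure of
   the union of the [B c] is collapsed to [None], restricted to X and [None]. *)
Definition extension (B : forall c, set (rem c)) : set (set (option X)) :=
  [set O | open (Some @^-1` O) /\ (O None -> forall c, exists W : set (K c),
    [/\ open W, forall r, B c r -> W (\val r) &
        forall z, W (e z) -> O (Some (j z))])].

(** * From a connectification to its traces on the remainders *)

Section trace_of_connectification.
Variables (S : set (set (option X))).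
Hypothesis S_conn : one_point_connectification S.
Hypothesis S_cr : completely_regular (gen_top S).
Hypothesis S_T1 : accessible_space (gen_top S).

Let openS : @open (gen_top S) = S. Proof. by case: S_conn. Qed.

Lemma trace_closed c : closed (trace S c).
Proof.
move=> r clr O SO ON; apply: closed_closure => V Vr.
have Vr' : nbhs r (\val @^-1` V) by exact: (@initial_continuous _ _ set_val r).
have [r' [tr' Vr'']] := clr _ Vr'.
by exists (\val r'); split => //; exact: tr'.
Qed.

(** Otherwise the component would be clopen in the connectification, its complement being [O]
    together with the other components. *)
Lemma component_meets_nbhs_None c O : S O -> O None -> exists z : Z c, O (Some (j z)).
Proof.
move=> SO ON; apply: contrapT => nz.
have oC d : open (range (@j d)) by apply: j_open; exact: openT.
have cC : open (~` range (@j c)).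
  apply: sum_openP => d; have [<-|dc] := pselect (c = d).
    rewrite -preimage_setC preimage_range setCT; exact: open0.
  rewrite (_ : _ @^-1` _ = setT); first exact: openT.
  by apply/seteqP; split => // z _ [z' _ /j_disjoint].
have [_ _ _ cS] := S_conn.
suff : Some @` range (@j c) = [set: gen_top S] by move/seteqP => [_ /(_ None Logic.I)] [].
apply: cS.
- by have [z _] := Z_point c; exists (Some (j z)), (j z) => //; exists z.
- exists (Some @` range (@j c)); last by rewrite setTI.
  by rewrite openS; apply: Some_open.
- exists (Some @` range (@j c)); last by rewrite setTI.
  rewrite -openC (_ : ~` _ = O `|` Some @` (~` range (@j c))).
    by apply: openU; rewrite openS //; apply: Some_open.
  apply/seteqP; split=> [[x|] nx|[x|]]; [|by left| |].
  + by right; exists x => // jx; apply: nx; exists x.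
  + move=> [Ox [_ [z _ <-] [zx]]|[y ny [<-]] [_ [z _ <-] [zy]]].
      by apply: nz; exists z; rewrite zx.
    by apply: ny; exists z.
  + by move=> _ [].
Qed.

(** Compactness of [K c] gives a cluster point of the neighbourhoods of [None] traced on the
    component. It lies in the remainder because [None] is separated from every point of [X]. *)
Lemma trace_nonempty c : trace S c !=set0.
Proof.
have [cK hK [ce ie oe] de _] := e_stone_cech c.
pose F := filter_from [set O : set (option X) | S O /\ O None]
  (fun O => e @` [set z : Z c | O (Some (j z))]).
have PF : ProperFilter F.
  apply: filter_from_proper => [|O [SO ON]]; last first.
    by have [z Oz] := component_meets_nbhs_None c SO ON; exists (e z), z.
  apply: filter_from_filter; first by exists setT; split => //; rewrite -openS; exact: openT.
  move=> O O' [SO ON] [SO' ON']; exists (O `&` O').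
    by split => //; rewrite -openS; apply: openI; rewrite openS.
  by move=> _ [z [Oz O'z] <-]; split; exists z.
have [k [_ Fk]] := cK F PF filterT.
have nk : (~` range e) k.
  move=> [z _ zk]; have hS := completely_regular_hausdorff S_cr S_T1.
  have [[U V] /= [UN Vz] [oU oV /eqP UV]] :
    exists2 AB, ((None : gen_top S) \in AB.1 /\ (Some (j z) : gen_top S) \in AB.2) &
                [/\ open AB.1, open AB.2 & AB.1 `&` AB.2 == set0].
    by move: hS; rewrite open_hausdorff; exact.
  have oVz : open [set y : Z c | V (Some (j y))].
    move/continuousP: (Some_continuous S_conn) => /(_ V oV).
    by move/continuousP: (@j_continuous c) => /[apply].
  have [W [oW VW]] := oe _ oVz.
  have Wk : W k.
    rewrite -zk -[W _]/((e @^-1` W) z) -VW; exact: set_mem Vz.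
  have [] := Fk (e @` [set z | U (Some (j z))]) W.
  - by exists U => //; split; [rewrite -openS|exact: set_mem].
  - exact: open_nbhs_nbhs.
  - move=> _ [[y Uy <-] Wy]; have : (U `&` V) (Some (j y)).
      by split => //; rewrite -[V _]/([set y | V (Some (j y))] y) VW.
    by rewrite UV.
exists (exist _ k (mem_set nk)) => O SO ON V Vk.
by apply: Fk => //; exists O.
Qed.

Lemma trace_closed_family : closed_family (trace S).
Proof. by move=> c; split; [exact: trace_closed|exact: trace_nonempty]. Qed.

(** A function that is 0 at [None] and 1 off [O] extends to [K c]. The trace lies in the closure of
    the set where it is below 1/2, so the open set where the extension is below 1 serves as [W]. *)
Lemma sub_extension_trace : S `<=` extension (trace S).
Proof.
move=> O SO; split.
  by move/continuousP: (Some_continuous S_conn); apply; rewrite openS.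
move=> ON c.
have [||f [cf f01 fN f1]] := S_cr (a := None) (B := ~` O).
- by apply: open_closedC; rewrite openS.
- by move=> /(_ ON).
have [||g [cg gE]] := stone_cech_real_extension (f := f \o Some \o j) (e_stone_cech c).
- move=> z; apply: (@continuous_comp _ _ _ j (f \o Some)); first exact: j_continuous.
  apply: (@continuous_comp _ (gen_top S) _ Some f); first exact: Some_continuous.
  exact: cf.
- by move=> z; exact: f01.
exists [set k | g k < 1]; split; first exact: open_lt_preimage.
  move=> r tr; rewrite /= ltNge; apply/negP => gr.
  have Sf : S [set y | f y < 2^-1] by rewrite -openS; exact: open_lt_preimage.
  have fN2 : f None < 2^-1 by rewrite fN invr_gt0.
  have [|k [[z /= fz zk]]] := tr _ Sf fN2 [set k | 2^-1 < g k].
    apply: open_nbhs_nbhs; split; first exact: open_gt_preimage.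
    by rewrite /= (lt_le_trans _ gr) // invf_lt1 // ltr1n.
  by rewrite -zk /= gE /= => /(lt_trans fz); rewrite ltxx.
move=> z; rewrite /= gE /= => fz; apply: contrapT => /f1 f1z.
by rewrite f1z ltxx in fz.
Qed.

End trace_of_connectification.

(** * From a family of closed sets to a connectification *)

Section extension_of_family.
Variable B : forall c, set (rem c).
Arguments B : clear implicits.
Hypothesis B_closed : closed_family B.
Hypothesis X_point : exists x : X, True.
Hypothesis X_cr : completely_regular X.
Hypothesis X_T1 : accessible_space X.

Local Notation S := (extension B).

Lemma extension_topology : is_topology S.
Proof.
apply: is_topologyP.
- split; first by exact: openT.
  by move=> _ c; exists setT; split => //; exact: openT.
- move=> O O' [P1 WO] [P2 WO']; split; first exact: openI.
  move=> [ON O'N] c; have [W [oW BW WOO]] := WO ON c.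
  have [W' [oW' BW' WOO']] := WO' O'N c.
  exists (W `&` W'); split; first exact: openI.
    by move=> r Br; split; [exact: BW|exact: BW'].
  by move=> z [Wz W'z]; split; [exact: WOO|exact: WOO'].
move=> F FS; split.
  rewrite preimage_bigcup; apply: bigcup_open => O FO.
  by have [] := FS _ FO.
move=> [V FV VN] c; have [_ /(_ VN c) [W [oW BW WV]]] := FS _ FV.
by exists W; split => // z Wz; exists V => //; exact: WV.
Qed.

Let openS : @open (gen_top S) = S. Proof. exact: extension_topology. Qed.

Lemma extension_Some_open (U : set X) : open U -> S (Some @` U).
Proof.
move=> oU; split; last by case.
by rewrite (_ : _ @^-1` _ = U) //; apply/seteqP; split=> [x [y Uy [<-]]//|x Ux]; exists x.
Qed.

Lemma extension_Some_continuous : continuous (Some : X -> gen_top S).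
Proof. by apply/continuousP => V; rewrite openS => -[]. Qed.

(** [W] contains a point of the nonempty [B c], and the component is dense in [K c]. *)
Lemma extension_meets O c : S O -> O None -> exists z : Z c, O (Some (j z)).
Proof.
move=> [_ /[apply] /(_ c) [W [oW BW WO]]].
have [_ [r Br]] := B_closed c; have [_ _ _ de _] := e_stone_cech c.
have [z Wz] := dense_range_meets de (open_nbhs_nbhs (conj oW (BW r Br))).
by exists z; exact: WO.
Qed.

Lemma extension_connectification : one_point_connectification S.
Proof.
split; first exact: extension_topology.
- move=> U; split=> [oU|[V [[oV _] ->]]//].
  exists (Some @` U); split; first exact: extension_Some_open.
  by apply/seteqP; split=> [x Ux|x [y Uy [<-]]//]; exists x.
- move=> V [y Vy]; rewrite openS => SV.
  case: y Vy => [x|] Vy; first by exists (Some x); split => //; exists x.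
  have [x0 _] := X_point; have [c _] := j_surj x0.
  by have [z Vz] := extension_meets c SV Vy; exists (Some (j z)); split => //; exists (j z).
(* A clopen set around [None] meets every component, hence contains each of them by
   connectedness. *)
have all_of_None (U : set (gen_top S)) : open U -> closed U -> U None -> U = setT.
  move=> oU cU UN; apply/seteqP; split => // -[x|] _ //.
  have [c [z <-]] := j_surj x.
  have [z0 Uz0] : exists z0 : Z c, U (Some (j z0)).
    by apply: extension_meets => //; rewrite -openS.
  have UE : range (@j c) `&` (Some @^-1` U) = range (@j c).
    apply: (@j_connected c).
    - by exists (j z0); split => //; exists z0.
    - exists (Some @^-1` U) => //.
      by move/continuousP: extension_Some_continuous; apply.
    - exists (Some @^-1` U) => //.
      by move/continuous_closedP: extension_Some_continuous; exact.
  have : range (@j c) (j z) by exists z.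
  by rewrite -UE => -[].
move=> U Une [V oV]; rewrite setTI => UV [V' cV']; rewrite setTI => UV'.
have [UN|UN] := pselect (U None).
  by apply: all_of_None => //; [rewrite UV|rewrite UV'].
have : ~` U = setT.
  by apply: all_of_None => //; [rewrite UV'; exact: closed_openC|rewrite UV; exact: open_closedC].
by have [y Uy] := Une => /seteqP [_ /(_ y Logic.I)].
Qed.

(** A compact subset of the component is closed in [K c], so its complement there is a neighbourhood
    of the whole remainder. *)
Lemma extension_compl_compact c (N : set (Z c)) : compact N ->
  S (~` (Some @` (j @` N))).
Proof.
move=> cN; have hX := completely_regular_hausdorff X_cr X_T1.
have [cK hK [ce ie oe] de _] := e_stone_cech c.
have comp_closed (T : topologicalType) (f : Z c -> T) :
    hausdorff_space T -> continuous f -> open (~` (f @` N)).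
  move=> hT cf; apply: closed_openC; apply: compact_closed => //.
  by apply: continuous_compact => //; exact: continuous_subspaceT.
split.
  rewrite (_ : _ @^-1` _ = ~` (j @` N)); first exact: comp_closed.
  apply/seteqP; split=> [x nx [z Nz zx]|x nx [_ [z Nz <-] [zx]]].
    by apply: nx; exists x => //; exists z.
  by apply: nx; exists z.
move=> _ d; have [cd|cd] := pselect (c = d); last first.
  exists setT; split => //; first exact: openT.
  by move=> z _ [_ [z' _ <-] [/j_disjoint]].
subst d; exists (~` (e @` N)); split; first exact: comp_closed.
  by move=> [r /= rr] _ [z _ zr]; apply: (set_mem rr); exists z.
move=> z nz [_ [z' Nz' <-] [/j_inj zz']]; apply: nz.
by exists z' => //; rewrite zz'.
Qed.

Lemma extension_T1 : accessible_space (gen_top S).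
Proof.
have cl1 := accessible_closed_set1 X_T1.
move=> [x|] y xy.
  exists (Some @` (~` (Some @^-1` [set y]))); split; first last.
  - by rewrite inE => -[x' nx' x'y]; exact: nx'.
  - by rewrite inE; exists x => //= e'; rewrite e' eqxx in xy.
  rewrite openS; apply: extension_Some_open; apply: closed_openC.
  case: y xy => [y|] _; last first.
    by rewrite (_ : _ @^-1` _ = set0); [exact: closed0|apply/seteqP; split].
  rewrite (_ : _ @^-1` _ = [set y]) //.
  by apply/seteqP; split=> [z [->]|z ->].
case: y xy => [y|] // _; have [c [z zy]] := j_surj y.
exists (~` (Some @` (j @` [set z]))); split.
- by rewrite openS; apply: extension_compl_compact; exact: compact_set1.
- by rewrite inE => -[].
- by rewrite !inE => /(_ _); apply; exists y => //; exists z.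
Qed.

Lemma extension_continuousP (f : gen_top S -> R) :
  continuous (f \o Some) ->
  (forall V, open V -> V (f None) -> forall c, exists W : set (K c),
    [/\ open W, forall r, B c r -> W (\val r) & forall z, W (e z) -> V (f (Some (j z)))]) ->
  continuous f.
Proof.
move=> cf fN; apply/continuousP => V oV; rewrite openS; split.
  by move/continuousP: cf => /(_ V oV).
by move=> VN c; exact: fN.
Qed.

(** Local compactness makes the remainder itself closed in [K c]. *)
Lemma rem_closed_image c : closed (\val @` B c).
Proof.
apply: set_val_closed_map; last by have [] := B_closed c.
exact/open_closedC/stone_cech_open_range.
Qed.

Lemma extension_completely_regular : completely_regular (gen_top S).
Proof.
move=> [x|] D cD nD; last first.
  (* At the new point: in each [K c] Urysohn's lemma separates [B c] from the complement of [W], and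
     the restrictions to the components glue together with the value 0 at [None]. *)
  have [_ /(_ nD) W_] : S (~` D) by rewrite -openS; exact: closed_openC.
  have hex : forall c, exists h : K c -> R, [/\ continuous h,
      (forall k, 0 <= h k <= 1), (forall r, B c r -> h (\val r) = 0) &
      forall z, D (Some (j z)) -> h (e z) = 1].
    move=> c; have [W [oW BW WD]] := W_ c.
    have [cK hK _ _ _] := e_stone_cech c.
    have [|h [ch h01 h0 h1]] := normal_urysohn (compact_normal hK cK)
        (@rem_closed_image c) (open_closedC oW).
      by apply/seteqP; split => // _ [[r Br <-]] /(_ (BW r Br)).
    exists h; split => // [r Br|z Dz]; first by apply: h0; exists r.
    by apply: h1 => /WD.
  pose h c := sval (cid (hex c)).
  have hP c : [/\ continuous (h c), (forall k, 0 <= h c k <= 1),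
      (forall r, B c r -> h c (\val r) = 0) &
      forall z, D (Some (j z)) -> h c (e z) = 1] := svalP (cid (hex c)).
  have [g gE] := sum_glue (fun c z => h c (e z)).
  exists (fun y => if y is Some x then g x else 0); split => //.
  - apply: extension_continuousP => [|V oV V0 c].
      apply: sum_continuousP => c.
      rewrite (_ : _ \o _ = h c \o e); last by apply/funext => z /=; rewrite gE.
      have [_ _ [ce _ _] _ _] := e_stone_cech c; have [ch _ _ _] := hP c.
      by move=> z; apply: continuous_comp; [exact: ce|exact: ch].
    have [ch _ h0 _] := hP c.
    exists (h c @^-1` V); split.
    + by move/continuousP: ch; apply.
    + by move=> r Br; rewrite /= h0.
    + by move=> z; rewrite /= gE.
  - move=> [x|]; last by rewrite lexx ler01.
    by have [c [z <-]] := j_surj x; rewrite gE; have [] := hP c.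
  - move=> [x|] Dx //; have [c [z zx]] := j_surj x.
    by rewrite -zx gE; have [_ _ _ ->] := hP c; rewrite ?zx.
(* At a point of [X]: the function is made 1 outside an open set contained in a compact
   neighbourhood, so the value 1 at [None] keeps it continuous. *)
have [c [z zx]] := j_surj x.
have [N] := @Z_locally_compact c z Logic.I.
rewrite withinET nbhsE => -[U [oU Uz] UN] [cN _].
have oV : open (j @` U `&` ~` (Some @^-1` D)).
  apply: openI; first exact: j_open.
  by apply: closed_openC; move/continuous_closedP: extension_Some_continuous; exact.
have [|f [cf f01 f0 f1]] := X_cr (a := x) (open_closedC oV).
  by case; split => //; exists z.
have fN z' : ~ N z' -> f (j z') = 1.
  by move=> nN; apply: f1 => -[[z1 Uz1 /j_inj zz1] _]; apply: nN; rewrite -zz1; exact: UN.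
exists (fun y => if y is Some x then f x else 1); split => //.
- apply: extension_continuousP => // W oW W1 d.
  have [_ /(_ _ d) [|W' [oW' BW' WO]]] := extension_compl_compact cN.
    by case.
  exists W'; split => // z' /WO nz'; rewrite f1 // => -[[z1 Uz1 zz1] _].
  by apply: nz'; exists (j z') => //; exists z1 => //; exact: UN.
- by move=> [y|] //; rewrite ler01 lexx.
- by move=> [y|] Dy //; apply: f1 => -[].
Qed.

Lemma extension_Ti i : Ti i X -> Ti i (gen_top S).
Proof.
have range_Some y : ~ range (Some : X -> option X) y -> y = None.
  by case: y => // x []; exists x.
case: i => -[hX _]; split; try exact: extension_T1.
- exact: extension_completely_regular.
- apply: (@one_point_extension_normal X (gen_top S) Some hX).
  + exact: extension_completely_regular.
  + exact: extension_Some_continuous.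
  + by move=> x y [].
  + by move=> U oU; rewrite openS; exact: extension_Some_open.
  + by move=> y y' /range_Some -> /range_Some ->.
(* A subspace of the extension adds at most the point [None] to its normal trace on [X]. *)
- move=> A; pose jA (x : set_type (Some @^-1` A)) : set_type A :=
    exist _ (Some (\val x)) (mem_set (set_mem (svalP x))).
  apply: (@one_point_extension_normal _ _ jA (hX (Some @^-1` A))).
  + exact: embedding_completely_regular (set_val_embedding _) extension_completely_regular.
  + apply: (@continuous_to_set_type _ _ _ jA) => x.
    apply: (@continuous_comp _ _ _ set_val (Some : X -> gen_top S)).
      exact: (@initial_continuous _ _ set_val x).
    exact: extension_Some_continuous.
  + by move=> x y /(congr1 (fun y => \val y)) [] /val_inj.
  + move=> _ [V oV <-]; exists (Some @` V); first by rewrite openS; exact: extension_Some_open.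
    apply/seteqP; split=> [[y Ay] /= [x Vx xy]|_ [x Vx <-]]; last by exists (\val x).
    have {}xy : Some x = y := xy; subst y.
    exists (exist _ x (mem_set (set_mem Ay))) => //.
    exact: val_inj.
  + move=> y y' ny ny'; apply: val_inj.
    have NA (w : set_type A) : ~ range jA w -> \val w = None.
      case: w => -[x|//] Ax []; exists (exist _ x (mem_set (set_mem Ax))) => //.
      exact: val_inj.
    by rewrite (NA y) // (NA y').
Qed.

(** Density of the component in [K c] puts [B c] inside the trace. Conversely, a remainder point
    outside [B c] is separated from it in [K c], and the open set around [B c] yields a
    neighbourhood of [None] that excludes the point from the trace. *)
Lemma trace_extension c : trace S c = B c.
Proof.
have [cK hK _ de _] := e_stone_cech c.
apply/seteqP; split=> r; last first.
  move=> Br O [_ WO] ON V Vr; have [W [oW BW WOj]] := WO ON c.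
  have [z [Wz Vz]] := dense_range_meets de
    (filterI (open_nbhs_nbhs (conj oW (BW r Br))) Vr).
  by exists (e z); split => //; exists z => //; exact: WOj.
move=> tr; apply: contrapT => nBr.
have [|P [Q [oP oQ Pr BQ PQ]]] := completely_regular_separation (a := \val r)
    (T4_completely_regular (compact_normal hK cK) (hausdorff_accessible hK))
    (@rem_closed_image c).
  by move=> [r' Br' /val_inj rr']; apply: nBr; rewrite -rr'.
(* [O] is cut out by [Q] on the component [c] and contains everything else. *)
pose O : set (option X) :=
  fun y => if y is Some x then forall z : Z c, j z = x -> Q (e z) else True.
have SO : S O.
  have Oc : (Some \o @j c) @^-1` O = e @^-1` Q.
    by apply/seteqP; split=> [z /(_ z erefl)//|z Qz z' /j_inj ->].
  have Od d : c <> d -> (Some \o @j d) @^-1` O = setT.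
    by move=> cd; apply/seteqP; split => // z _ z' /j_disjoint.
  split.
    apply: sum_openP => d; have [cd|/Od] := pselect (c = d); last first.
      by rewrite comp_preimage => ->; exact: openT.
    subst d; rewrite -comp_preimage Oc.
    by have [_ _ [ce _ _] _ _] := e_stone_cech c; move/continuousP: ce; apply.
  move=> _ d; have [cd|cd] := pselect (c = d); last first.
    by exists setT; split=> [||z _ z' /j_disjoint//] //; exact: openT.
  subst d; exists Q; split => //.
    by move=> r' Br'; apply: BQ; exists r'.
  by move=> z Qz z' /j_inj ->.
have [k [[z Oz zk] Pk]] := tr O SO Logic.I P (open_nbhs_nbhs (conj oP Pr)).
have : (P `&` Q) k by split => //; rewrite -zk; exact: Oz.
by rewrite PQ.
Qed.

End extension_of_family.
End sum_of_components.

(** * Order isomorphisms *)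

Definition point_family (I : Type) (P : I -> Type) (x : forall c, P c) c : set (P c) :=
  [set x c].

(* [T] and [A] form a Galois connection between connectifications and families of
   nonempty closed subsets of the factors [P c]. *)
Definition represents (i : sep_index) (X : topologicalType) (I : Type)
    (P : I -> topologicalType) (T : (forall c, set (P c)) -> set (set (option X)))
    (A : set (set (option X)) -> forall c, set (P c)) :=
  [/\ forall B, closed_family B -> Yi i X (T B),
      forall S, Yi i X S -> closed_family (A S),
      forall B, closed_family B -> forall c, A (T B) c = B c &
      forall S B, Yi i X S -> closed_family B ->
        (S `<=` T B <-> forall c, B c `<=` A S c)].

Lemma point_family_closed (I : Type) (P : I -> topologicalType) (x : forall c, P c) :
  (forall c (r : P c), closed [set r]) -> closed_family (point_family x).
Proof. by move=> closed1 c; split; [exact: closed1|exists (x c)]. Qed.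

Lemma point_family_box (I : Type) (P : I -> Type) (x : forall c, P c) (B : forall c, set (P c)) :
  box B x <-> forall c, point_family x (c := c) `<=` B c.
Proof. by split=> [Bx c _ ->|Bx c]; [exact: Bx|exact: Bx]. Qed.

Lemma closed_family_point (I : Type) (P : I -> topologicalType)
    (B : forall c, set (P c)) : closed_family B -> exists x, box B x.
Proof.
move=> Bcl; exists (fun c => sval (cid (Bcl c).2)) => c.
exact: (svalP (cid (Bcl c).2)).
Qed.

Section order_isomorphism.
Variables (i : sep_index) (X X' : topologicalType) (I I' : Type).
Variables (P : I -> topologicalType) (P' : I' -> topologicalType).
Hypothesis closed1 : forall c (r : P c), closed [set r].
Hypothesis closed1' : forall c (r : P' c), closed [set r].
Variables (T : (forall c, set (P c)) -> set (set (option X)))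
  (A : set (set (option X)) -> forall c, set (P c))
  (T' : (forall c, set (P' c)) -> set (set (option X')))
  (A' : set (set (option X')) -> forall c, set (P' c)).
Hypotheses (TA : represents i T A) (TA' : represents i T' A').

Lemma point_family_inj (x y : forall c, P c) :
  T (point_family x) = T (point_family y) -> x = y.
Proof.
case: TA => _ _ AT _ Txy; apply: functional_extensionality_dep => c.
have := AT _ (point_family_closed x closed1) c.
by rewrite Txy AT; [move/seteqP => [_ /(_ _ erefl)]|exact: point_family_closed].
Qed.

(* The topologies of the point families are the maximal ones, so an order
   isomorphism permutes them. *)
Lemma order_isomorphism_points (phi : set (set (option X)) -> set (set (option X'))) :
  set_bij (Yi i X) (Yi i X') phi ->
  (forall S1 S2, Yi i X S1 -> Yi i X S2 -> (S1 `<=` S2 <-> phi S1 `<=` phi S2)) ->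
  exists s : (forall c, P c) -> forall c, P' c,
    (forall x, phi (T (point_family x)) = T' (point_family (s x))) /\ box_preserving s.
Proof.
move=> [phiY _ phi_surj] phi_le.
case: TA => TY Acl AT TAadj; case: TA' => TY' Acl' AT' TAadj'.
have pcl x := point_family_closed x closed1; have pcl' x := point_family_closed x closed1'.
have phiYi S : Yi i X S -> Yi i X' (phi S) by move=> YS; exact: phiY.
have /choice[s sP] : forall x, exists x', phi (T (point_family x)) = T' (point_family x').
  move=> x; set S := T _; have YS : Yi i X S by exact: TY.
  have [x' x'P] := closed_family_point (Acl' _ (phiYi _ YS)).
  exists x'.
  have le1 : phi S `<=` T' (point_family x').
    by apply/(TAadj' _ _ (phiYi _ YS) (pcl' _))/point_family_box.
  have [S2 YS2 S2E] := phi_surj _ (TY' _ (pcl' x')).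
  rewrite -S2E in le1 *; move/phi_le: le1 => /(_ YS YS2) SS2.
  suff -> : S = S2 by [].
  (* Maximality of [S]: the traces of the larger [S2] are nonempty subsets of the singletons of the
     coordinates of [x], hence equal to them. *)
  apply/seteqP; split => //; apply/(TAadj _ _ YS2 (pcl x)) => c _ ->.
  have AS2 d : A S2 (c := d) `<=` A S (c := d).
    move: d.
    apply/(TAadj _ _ YS (Acl _ YS2)); apply: (subset_trans SS2).
    by apply/(TAadj _ _ YS2 (Acl _ YS2)) => d r.
  have [_ [r rA]] := Acl _ YS2 c.
  by have := AS2 c r rA; rewrite AT // => rx; rewrite -rx.
exists s; split => // B Bcl; exists (A' (phi (T B))); split.
  by apply: Acl'; apply: phiYi; exact: TY.
(* Membership of [x] in the box means that [T B] lies below the connectification of [x], a relation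
   that [phi] preserves. *)
move=> x; have YB := TY _ Bcl; have Yx := TY _ (pcl x).
rewrite !point_family_box -(TAadj' _ _ (phiYi _ YB) (pcl' (s x))) -sP.
rewrite -(phi_le _ _ YB Yx) (TAadj _ _ YB (pcl x)).
by split=> H c; have := H c; rewrite AT.
Qed.

End order_isomorphism.

(** * Components as summands, and the matching of their remainders *)

Lemma closed_set1_sub (T : topologicalType) (A : set T) (r : set_type A) :
  accessible_space T -> closed [set r].
Proof.
move=> aT; apply: accessible_closed_set1.
exact: embedding_accessible (set_val_embedding A) aT.
Qed.

Lemma locally_connected_open_component (X : topologicalType) (C : set X) :
  locally_connected X -> component C -> open C.
Proof.
move=> lX [x ->]; rewrite openE => y xy.
have [V [oV Vy cV _]] := lX y setT (@filterT _ _ _).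
rewrite /interior (@same_connected_component _ _ x y) //.
apply: (@filterS _ _ _ V); last exact: open_nbhs_nbhs.
exact: connected_component_max.
Qed.

Lemma component_eq (X : topologicalType) (C D : set X) x :
  component C -> component D -> C x -> D x -> C = D.
Proof.
move=> [a ->] [b ->] ax bx.
by rewrite (same_connected_component ax) (same_connected_component bx).
Qed.

(** The sum is instantiated with the components: local connectedness makes them open, and being
    closed they inherit local compactness. *)
Lemma connectifications_represented (i : sep_index) (X : topologicalType) (x0 : X)
    (K : set_type (@component X) -> topologicalType)
    (e : forall c, set_type (\val c : set X) -> K c) :
  locally_connected X -> locally_compact [set: X] -> Ti i X ->
  (forall c, stone_cech (e c)) ->
  exists T A, @represents i X _ (fun c => sc_remainder (e c)) T A.
Proof.
move=> lX cX TX se; have [crX aX] := Ti_completely_regular TX.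
pose j (c : set_type (@component X)) : set_type (\val c : set X) -> X := set_val.
have compC (c : set_type (@component X)) : component (\val c) := set_mem (svalP c).
have j_cont c : continuous (j c) by exact: initial_continuous.
have j_open c U : open U -> open (j c @` U).
  by apply: set_val_open_map; exact: locally_connected_open_component.
have j_inj c : injective (j c) by exact: val_inj.
have j_disj c d z z' : j c z = j d z' -> c = d.
  move=> zz'; apply: val_inj.
  apply: (@component_eq _ _ _ (j c z)) => //; first exact: set_mem (svalP z).
  by rewrite zz'; exact: set_mem (svalP z').
have j_surj x : exists c z, j c z = x.
  have Cx : component (connected_component [set: X] x) by exists x.
  have xC : connected_component [set: X] x x by exact: connected_component_refl.
  pose c : set_type (@component X) :=
    exist (fun C => C \in (@component X : set (set X))) _ (mem_set Cx).
  by exists c, (exist (fun y => y \in (\val c : set X)) x (mem_set xC)).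
have j_conn c : connected (range (j c)).
  rewrite (_ : range (j c) = \val c).
    by have [x ->] := compC c; exact: component_connected.
  apply/seteqP; split=> [_ [z _ <-]|x cx]; first exact: set_mem (svalP z).
  by exists (exist _ x (mem_set cx)).
have Z_pt (c : set_type (@component X)) : exists z : set_type (\val c : set X), True.
  have [x cE] := compC c.
  have xC : (\val c : set X) x by rewrite cE; exact: connected_component_refl.
  by exists (exist _ x (mem_set xC)).
have Z_lc (c : set_type (@component X)) : locally_compact [set: set_type (\val c : set X)].
  apply: closed_set_type_locally_compact => //.
  by have [x ->] := compC c; exact: component_closed closedT.
have Xpt : exists x : X, True by exists x0.
pose T := @extension X _ _ j K e; pose A := @trace X _ _ j K e.
have AT B (Bcl : closed_family B) c : A (T B) c = B c.
  exact: (trace_extension j_open j_inj j_disj j_surj Z_lc se Bcl c).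
exists T, A; split => //.
- move=> B Bcl; split; first exact: (extension_connectification j_surj j_conn se Bcl Xpt).
  exact: (extension_Ti j_cont j_open j_inj j_disj j_surj Z_lc se Bcl crX aX).
- move=> S [cS /Ti_completely_regular [crS aS]].
  exact: (trace_closed_family j_cont j_open j_disj j_surj Z_pt se cS crS aS).
(* Both [trace] and [extension] reverse inclusions, so the equivalence follows from [A (T B) = B]
   and from [S] lying in [T (A S)]. *)
- move=> S B YS Bcl; have [cS /Ti_completely_regular [crS aS]] := YS; split.
    move=> SB c; rewrite -AT // => r tr V SV; apply: tr; exact: SB.
  move=> BA V SV.
  have [oV WV] := @sub_extension_trace X _ _ j j_cont K e se S cS crS V SV.
  split => // VN c; have [W [oW AW WVj]] := WV VN c.
  by exists W; split => // r Br; apply: AW; exact: BA.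
Qed.

(** The empty set is not dense in the one remaining point. *)
Lemma empty_connectification (i : sep_index) (X : topologicalType) :
  (X -> False) -> Yi i X = set0.
Proof.
move=> X0; apply/seteqP; split => // S [[oS _ dS _] _].
have [|y [_ [x _ _]]] := dS setT _ openT; first by exists None.
by case: (X0 x).
Qed.

Lemma stone_cech_components (i : sep_index) (X : topologicalType) : Ti i X ->
  exists (K : set_type (@component X) -> topologicalType)
    (e : forall c, set_type (\val c : set X) -> K c), forall c, stone_cech (e c).
Proof.
move=> /Ti_completely_regular [crX aX].
have H (c : set_type (@component X)) :
    exists (K : topologicalType) (e : set_type (\val c : set X) -> K),
    stone_cech e.
  apply: stone_cech_exists.
    exact: embedding_completely_regular (set_val_embedding _) crX.
  exact: embedding_accessible (set_val_embedding _) aX.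
exists (fun c => sval (cid (H c))), (fun c => sval (cid (svalP (cid (H c))))) => c.
exact: (svalP (cid (svalP (cid (H c))))).
Qed.

Lemma homeomorphic_trans (A B C : topologicalType) :
  homeomorphic A B -> homeomorphic B C -> homeomorphic A C.
Proof.
move=> [f [g [cf cg fK gK]]] [f' [g' [cf' cg' fK' gK']]].
exists (f' \o f), (g \o g'); split.
- by move=> x; apply: continuous_comp; [exact: cf|exact: cf'].
- by move=> x; apply: continuous_comp; [exact: cg'|exact: cg].
- exact: can_comp.
- exact: can_comp.
Qed.

Lemma Yi_order_isomorphism (i : sep_index) (X X' : topologicalType) :
  Yi_order_isomorphic i X X' ->
  exists (phi : set (set (option X)) -> set (set (option X')))
    (psi : set (set (option X')) -> set (set (option X))),
  [/\ set_bij (Yi i X) (Yi i X') phi /\ set_bij (Yi i X') (Yi i X) psi,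
     forall S1 S2, Yi i X S1 -> Yi i X S2 -> (S1 `<=` S2 <-> phi S1 `<=` phi S2),
     forall S1 S2, Yi i X' S1 -> Yi i X' S2 -> (S1 `<=` S2 <-> psi S1 `<=` psi S2),
     forall S, Yi i X S -> psi (phi S) = S &
     forall S, Yi i X' S -> phi (psi S) = S].
Proof.
move=> [phi [bphi le]]; have [phiY phi_inj phi_surj] := bphi.
have /choice[psi psiP] : forall S', exists S, Yi i X' S' -> Yi i X S /\ phi S = S'.
  (* Off [Yi i X'] the inverse takes the default value [set0]. *)
  move=> S'; have [YS'|nYS'] := pselect (Yi i X' S'); last by exists set0.
  by have [S YS SS'] := phi_surj S' YS'; exists S.
have psiY S' : Yi i X' S' -> Yi i X (psi S') by move=> /psiP [].
have psiK S' : Yi i X' S' -> phi (psi S') = S' by move=> /psiP [].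
have phiYi S : Yi i X S -> Yi i X' (phi S) by move=> YS; exact: phiY.
have phiK S : Yi i X S -> psi (phi S) = S.
  move=> YS; apply: phi_inj; rewrite ?inE //; first exact/psiY/phiYi.
  exact/psiK/phiYi.
have le' S1 S2 : Yi i X S1 -> Yi i X S2 -> (S1 `<=` S2 <-> phi S1 `<=` phi S2).
  move=> Y1 Y2; rewrite -(conn_leE Y1 Y2) -(conn_leE (phiYi _ Y1) (phiYi _ Y2)).
  exact: le.
exists phi, psi; split => //.
- split => //; split.
  + exact: psiY.
  + move=> S1 S2; rewrite !inE => Y1 Y2 E.
    by rewrite -(psiK S1) // -(psiK S2) // E.
  + by move=> S YS; exists (phi S); [exact: phiYi|exact: phiK].
- move=> S1 S2 Y1 Y2; rewrite le'; [|exact: psiY|exact: psiY].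
  by rewrite !psiK.
Qed.

(** The order isomorphism and its inverse induce mutually inverse box-preserving maps [s] and [t]
    between the products of the remainders. *)
Lemma components_bijection (i : sep_index) (X X' : topologicalType) (x0 : X) (x0' : X')
    (K : set_type (@component X) -> topologicalType)
    (e : forall c, set_type (\val c : set X) -> K c)
    (K' : set_type (@component X') -> topologicalType)
    (e' : forall c, set_type (\val c : set X') -> K' c) :
  locally_connected X -> locally_compact [set: X] -> Ti i X ->
  locally_connected X' -> locally_compact [set: X'] -> Ti i X' ->
  (forall c, stone_cech (e c)) -> (forall c, stone_cech (e' c)) ->
  (forall c, card_ge3 (sc_remainder (e c))) ->
  (forall c, card_ge3 (sc_remainder (e' c))) ->
  Yi_order_isomorphic i X X' ->
  exists (f : set_type (@component X) -> set_type (@component X')) g,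
    [/\ cancel f g, cancel g f &
        forall c, homeomorphic (sc_remainder (e c)) (sc_remainder (e' (f c)))].
Proof.
move=> lX cX TX lX' cX' TX' se se' ge3 ge3' iso.
have [T [A TA]] := connectifications_represented x0 lX cX TX se.
have [T' [A' TA']] := connectifications_represented x0' lX' cX' TX' se'.
have other (P : topologicalType) (r : P) : card_ge3 P -> exists r', r <> r'.
  by move=> [a [b [_ [ab _ _]]]]; have [->|ra] := pselect (r = a); [exists b|exists a].
have cl c (r : sc_remainder (e c)) : closed [set r].
  by apply: closed_set1_sub; case: (se c) => _ /hausdorff_accessible.
have cl' c (r : sc_remainder (e' c)) : closed [set r].
  by apply: closed_set1_sub; case: (se' c) => _ /hausdorff_accessible.
have [phi [psi [[bphi bpsi] le_phi le_psi phiK psiK]]] := Yi_order_isomorphism iso.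
have [s [sP sB]] := order_isomorphism_points cl cl' TA TA' bphi le_phi.
have [t [tP tB]] := order_isomorphism_points cl' cl TA' TA bpsi le_psi.
have YT x : Yi i X (T (point_family x)).
  by case: TA => + _ _ _; apply; exact: point_family_closed.
have YT' x : Yi i X' (T' (point_family x)).
  by case: TA' => + _ _ _; apply; exact: point_family_closed.
have sK : cancel s t.
  by move=> x; apply: (point_family_inj cl TA); rewrite -tP -sP phiK.
have tK : cancel t s.
  by move=> x; apply: (point_family_inj cl' TA'); rewrite -sP -tP psiK.
apply: (@box_preserving_factors _ _ _ _ s t) => //.
- by move=> c; have [r _] := cid (ge3 c).
- by move=> c r; exact: other.
- by move=> c r; exact: other.
Qed.

(** The family of whole remainders is admissible. With [empty_connectification] this excludes that
    exactly one of the two spaces is empty. *)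
Lemma connectification_exists (i : sep_index) (X : topologicalType) (x0 : X)
    (K : set_type (@component X) -> topologicalType)
    (e : forall c, set_type (\val c : set X) -> K c) :
  locally_connected X -> locally_compact [set: X] -> Ti i X ->
  (forall c, stone_cech (e c)) -> (forall c, card_ge3 (sc_remainder (e c))) ->
  Yi i X !=set0.
Proof.
move=> lX cX TX se ge3.
have [T [A [TY _ _ _]]] := connectifications_represented x0 lX cX TX se.
exists (T (fun _ => setT)); apply: TY => c; split; first exact: closedT.
by have [r _] := ge3 c; exists r.
Qed.

Theorem theorem3p3 (i : sep_index) (X X' : topologicalType) :
  locally_connected X -> locally_compact [set: X] -> Ti i X ->
  locally_connected X' -> locally_compact [set: X'] -> Ti i X' ->
  (forall C : set X, component C ->
     forall (K : topologicalType) (e : set_type C -> K),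
       stone_cech e -> card_ge3 (sc_remainder e)) ->
  (forall C' : set X', component C' ->
     forall (K' : topologicalType) (e' : set_type C' -> K'),
       stone_cech e' -> card_ge3 (sc_remainder e')) ->
  Yi_order_isomorphic i X X' ->
  exists psi : set X -> set X',
    set_bij (@component X) (@component X') psi /\
    forall C : set X, component C ->
      forall (K : topologicalType) (e : set_type C -> K)
             (K' : topologicalType) (e' : set_type (psi C) -> K'),
        stone_cech e -> stone_cech e' ->
        homeomorphic (sc_remainder e) (sc_remainder e').
Proof.
move=> lX cX TX lX' cX' TX' ge3 ge3' iso.
have [K [e se]] := stone_cech_components TX.
have [K' [e' se']] := stone_cech_components TX'.
have compX (c : set_type (@component X)) : component (\val c) := set_mem (svalP c).
have compX' (c : set_type (@component X')) : component (\val c) := set_mem (svalP c).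
have cardX c : card_ge3 (sc_remainder (e c)) by exact: ge3 (se c).
have cardX' c : card_ge3 (sc_remainder (e' c)) by exact: ge3' (se' c).
have [f [g [fK gK fH]]] : exists (f : set_type (@component X) ->
    set_type (@component X')) g, [/\ cancel f g, cancel g f &
    forall c, homeomorphic (sc_remainder (e c)) (sc_remainder (e' (f c)))].
  have no_component (Y : topologicalType) : (Y -> False) -> set_type (@component Y) -> False.
    by move=> Y0 c; have [y _] : component (\val c) := set_mem (svalP c); exact: Y0 y.
  have [phi [rho [[[phiY _ _] [psiY _ _]] _ _ _ _]]] := Yi_order_isomorphism iso.
  have [[x0 _]|X0] := pselect (exists x : X, True);
    have [[x0' _]|X0'] := pselect (exists x : X', True).
  - exact: (components_bijection x0 x0' lX cX TX lX' cX' TX' se se').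
  - have [S /phiY] := connectification_exists x0 lX cX TX se cardX.
    by rewrite empty_connectification // => x; apply: X0'; exists x.
  - have [S /psiY] := connectification_exists x0' lX' cX' TX' se' cardX'.
    by rewrite empty_connectification // => x; apply: X0; exists x.
  (* Both spaces are empty, so there are no components to match. *)
  - have {}X0 : X -> False by move=> x; apply: X0; exists x.
    have {}X0' : X' -> False by move=> x; apply: X0'; exists x.
    exists (fun c => False_rect _ (no_component X X0 c)),
      (fun c => False_rect _ (no_component X' X0' c)).
    by split=> [c|c|c]; [case: (no_component X X0 c)|case: (no_component X' X0' c)
      |case: (no_component X X0 c)].
(* [psi] must be total on sets; those that are not components go to [set0]. *)
pose psi (C : set X) : set X' :=
  if pselect (component C) is left CC then \val (f (exist _ C (mem_set CC))) else set0.
have psiE (c : set_type (@component X)) : psi (\val c) = \val (f c).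
  rewrite /psi; case: pselect => [CC|]; last by case; exact: compX.
  by congr (\val (f _)); exact: val_inj.
have lift C : component C -> exists c : set_type (@component X), C = \val c.
  by move=> CC; exists (exist _ C (mem_set CC)).
exists psi; split.
- split.
  + by move=> C /lift [c ->]; rewrite psiE; exact: compX'.
  + move=> C D; rewrite !inE => /lift [c ->] /lift [d ->].
    by rewrite !psiE => /val_inj /(can_inj fK) ->.
  + move=> C' CC'; pose c' : set_type (@component X') := exist _ C' (mem_set CC').
    by exists (\val (g c')); [exact: compX|rewrite psiE gK].
(* Uniqueness of remainders links the arbitrary compactifications to the chosen ones on both
   sides. *)
move=> _ /lift [c ->]; rewrite psiE => L a L' a' sa sa'.
apply: homeomorphic_trans (stone_cech_remainder_unique sa (se c)) _.
apply: homeomorphic_trans (fH c) _.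
exact: stone_cech_remainder_unique (se' (f c)) sa'.
Qed.
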